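(* Let $m\ge2$ and for each $k\in\{0,\dots,m-1\}$ let $\mathbb S_k$ be a set of permissible states of type $k$, each $S_k\in\mathbb S_k$ having a cost $0\le\mathcal L(S_k)\le N$ ($N>0$ real) and transition probabilities $q_j(S_k)$, $j\in\{0,\dots,m-1\}$, summing to $1$, with $q_0(S_k)\ge\beta>0$ for all $k$ and all $S_k\in\mathbb S_k$. Let $\mathbb S=\mathbb S_0\times\dots\times\mathbb S_{m-1}$ and let $\mathbf S^*=(S_0^*,\dots,S_{m-1}^* )\in\mathbb S$ be a solution of the minimum cost Markov chain problem whose multi-typed intersection point $(\mathbf x^*,y^* )$ satisfies $y^*=\mathrm{height}(\mathbb H)$. Then $\mathbf x^*\in[-\beta^{-1}N,\beta^{-1}N]^{m-1}$.
   Context: A tuple $\mathbf S=(S_0,\dots,S_{m-1})\in\mathbb S$ is viewed as an $m$-state Markov chain in which state $k$ transitions to state $j$ with probability $q_j(S_k)$; since $q_0>0$ it has a unique stationary distribution $\pi(\mathbf S)$, and $\mathrm{Cost}(\mathbf S)=\sum_k\mathcal L(S_k)\pi_k(\mathbf S)$. The minimum cost Markov chain problem is to find $\mathbf S\in\mathbb S$ minimizing $\mathrm{Cost}(\mathbf S)$. For $\mathbf x=(x_1,\dots,x_{m-1})\in\mathbb R^{m-1}$ define $f_0(\mathbf x,S_0)=\mathcal L(S_0)+\sum_{j=1}^{m-1}q_j(S_0)x_j$ and, for $k>0$, $f_k(\mathbf x,S_k)=\mathcal L(S_k)+\sum_{j=1}^{m-1}q_j(S_k)x_j-x_k$. For $\mathbf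 S\in\mathbb S$, the $m$ hyperplanes $y=f_k(\mathbf x,S_k)$, $k=0,\dots,m-1$, in $\mathbb R^m$ meet in a unique point $(\mathbf x,y)$, called the multi-typed intersection of $\mathbf S$; it satisfies $y=\mathrm{Cost}(\mathbf S)$ and $f_k(\mathbf x,S_k)=y$ for all $k$. Let $g_k(\mathbf x)=\min_{S_k\in\mathbb S_k}f_k(\mathbf x,S_k)$, $h(\mathbf x)=\min_kg_k(\mathbf x)$, $\mathbb H=\{(\mathbf x,y)\in\mathbb R^m: 0\le y\le h(\mathbf x)\}$, and $\mathrm{height}(\mathbb H)=\max_{(\mathbf x,y)\in\mathbb H}y$. *)

(* Defs.v *)
From HB Require Import structures.
From mathcomp Require Import all_boot all_order all_algebra.
From mathcomp Require Import mathcomp_extra boolp classical_sets reals.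

Set Implicit Arguments.
Unset Strict Implicit.
Unset Printing Implicit Defensive.

Import Order.TTheory GRing.Theory Num.Theory.

Local Open Scope classical_set_scope.
Local Open Scope ring_scope.

(* The number of states is m = n.+1. State types are k : 'I_n.+1, and a vector *)
(* x = (x_1, ..., x_(m-1)) is a row vector 'rV_n whose 0-based entry i is the  *)
(* coordinate x_(i+1), i.e., the one attached to the state type lift ord0 i.   *)
(* St k is the set of permissible states of type k, L the cost, and q k s j    *)
(* the probability of moving from the state s of type k to type j. The product *)
(* of the St k is the dependent function type forall k, St k.                  *)

Definition has_minimum (R : realType) (A : set R) : Prop :=
  exists2 v, A v & forall w, A w -> v <= w.

Definition has_maximum (R : realType) (A : set R) : Prop :=
  exists2 v, A v & forall w, A w -> w <= v.

Definition transition_mx (R : realType) (n : nat) (St : 'I_n.+1 -> Type)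
    (q : forall k, St k -> 'I_n.+1 -> R) (S : forall k, St k) : 'M[R]_n.+1 :=
  \matrix_(k, j) q k (S k) j.

Definition is_stationary (R : realType) (n : nat) (P : 'M[R]_n.+1)
    (p : 'rV[R]_n.+1) : Prop :=
  [/\ forall k, 0 <= p 0 k, \sum_k p 0 k = 1 & p *m P = p].

(* xget selects a stationary distribution, which is unique as soon as all the *)
(* q k s 0 are positive; the default value 0 is then irrelevant.              *)
Definition stationary_distr (R : realType) (n : nat) (St : 'I_n.+1 -> Type)
    (q : forall k, St k -> 'I_n.+1 -> R) (S : forall k, St k) : 'rV[R]_n.+1 :=
  xget 0 [set p | is_stationary (transition_mx q S) p].

Definition Cost (R : realType) (n : nat) (St : 'I_n.+1 -> Type)
    (L : forall k, St k -> R) (q : forall k, St k -> 'I_n.+1 -> R)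
    (S : forall k, St k) : R :=
  \sum_k L k (S k) * stationary_distr q S 0 k.

Definition min_cost_solution (R : realType) (n : nat) (St : 'I_n.+1 -> Type)
    (L : forall k, St k -> R) (q : forall k, St k -> 'I_n.+1 -> R)
    (S : forall k, St k) : Prop :=
  forall S' : forall k, St k, Cost L q S <= Cost L q S'.

(* unlift ord0 k is None for k = 0, and Some i for k = lift ord0 i. *)
Definition f (R : realType) (n : nat) (St : 'I_n.+1 -> Type)
    (L : forall k, St k -> R) (q : forall k, St k -> 'I_n.+1 -> R)
    (k : 'I_n.+1) (x : 'rV[R]_n) (s : St k) : R :=
  L k s + \sum_(j < n) q k s (lift ord0 j) * x 0 j
  - (if unlift ord0 k is Some i then x 0 i else 0).

Definition multi_typed_intersection (R : realType) (n : nat)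
    (St : 'I_n.+1 -> Type) (L : forall k, St k -> R)
    (q : forall k, St k -> 'I_n.+1 -> R) (S : forall k, St k)
    (x : 'rV[R]_n) (y : R) : Prop :=
  forall k, y = f L q x (S k).

(* An infimum that is a minimum whenever has_minimum (range (f L q x)). *)
Definition g (R : realType) (n : nat) (St : 'I_n.+1 -> Type)
    (L : forall k, St k -> R) (q : forall k, St k -> 'I_n.+1 -> R)
    (k : 'I_n.+1) (x : 'rV[R]_n) : R :=
  inf (range (@f R n St L q k x)).

Definition h (R : realType) (n : nat) (St : 'I_n.+1 -> Type)
    (L : forall k, St k -> R) (q : forall k, St k -> 'I_n.+1 -> R)
    (x : 'rV[R]_n) : R :=
  \big[Num.min/g L q ord0 x]_(k < n.+1) g L q k x.

Definition H (R : realType) (n : nat) (St : 'I_n.+1 -> Type)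
    (L : forall k, St k -> R) (q : forall k, St k -> 'I_n.+1 -> R) :
    set ('rV[R]_n * R) :=
  [set p | 0 <= p.2 <= h L q p.1].

(* A supremum that is a maximum whenever has_maximum (snd @` A). *)
Definition height (R : realType) (n : nat) (A : set ('rV[R]_n * R)) : R :=
  sup (snd @` A).

(* Main.v *)
Require Import Defs.
From mathcomp Require Import all_boot all_order all_algebra.
From mathcomp Require Import mathcomp_extra boolp classical_sets reals.
From mathcomp Require Import lra.

Import Order.TTheory GRing.Theory Num.Theory.

Local Open Scope classical_set_scope.
Local Open Scope ring_scope.

(** Put [X_0 = 0] and [X_k = x_k]. The intersection point solves the Poisson
equation [y + X_k = L_k + \sum_j q_kj X_j]. At a state [k] maximizing [X], the
right-hand side is at most [L_k + (1 - q_k0) X_k] because [X_0 = 0], hence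
[q_k0 X_k <= L_k - y], where [X_k >= X_0 = 0]; this bounds [X] from above and
gives [y <= N]. The same argument for [-X] bounds [X] from below and gives
[0 <= y]. *)

Lemma poisson_maximum_principle {R : realFieldType} {n : nat}
    {P : 'I_n.+1 -> 'I_n.+1 -> R} {c X : 'I_n.+1 -> R} {y beta : R} :
  0 <= beta -> (forall k j, 0 <= P k j) -> (forall k, \sum_j P k j = 1) ->
  (forall k, beta <= P k ord0) -> X ord0 = 0 ->
  (forall k, y + X k = c k + \sum_j P k j * X j) ->
  exists k, 0 <= c k - y /\ forall i, beta * X i <= c k - y.
Proof.
move=> beta_ge0 P_ge0 P_sum1 P0_ge X0 eqX.
have [k _ maxX] := @arg_maxP _ _ _ ord0 predT X isT.
have Xk_ge0 : 0 <= X k by rewrite -X0; exact: maxX.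
have le_sum : \sum_j P k j * X j <= (1 - P k ord0) * X k.
  (* Writing [1] as the row sum turns [1 - P k ord0] into the sum of the weights with [j > 0]; the
     term [j = 0] on the left vanishes since [X ord0 = 0]. *)
  rewrite -(P_sum1 k) !big_ord_recl X0 mulr0 add0r addrAC subrr add0r mulr_suml.
  by apply: ler_sum => j _; rewrite ler_wpM2l //; exact: maxX.
have Pk_le : P k ord0 * X k <= c k - y by have := eqX k; lra.
have bXk_le : beta * X k <= c k - y.
  by apply: le_trans Pk_le; rewrite ler_wpM2r.
exists k; split=> [|i]; first exact: le_trans (mulr_ge0 beta_ge0 Xk_ge0) bXk_le.
by apply: le_trans bXk_le; rewrite ler_wpM2l //; exact: maxX.
Qed.

Theorem theorem1 (R : realType) (n : nat) (m_ge2 : (2 <= n.+1)%N)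
    (St : 'I_n.+1 -> Type)
    (L : forall k, St k -> R) (q : forall k, St k -> 'I_n.+1 -> R)
    (N beta : R) (N_gt0 : 0 < N) (beta_gt0 : 0 < beta)
    (L_bound : forall k (s : St k), 0 <= L k s <= N)
    (q_ge0 : forall k (s : St k) j, 0 <= q k s j)
    (q_sum1 : forall k (s : St k), \sum_(j < n.+1) q k s j = 1)
    (q0_ge_beta : forall k (s : St k), beta <= q k s ord0)
    (g_min : forall k (x : 'rV[R]_n), has_minimum (range (@f R n St L q k x)))
    (height_max : has_maximum (snd @` H L q))
    (Sstar : forall k, St k) (Sstar_opt : min_cost_solution L q Sstar)
    (xstar : 'rV[R]_n) (ystar : R)
    (xy_inter : multi_typed_intersection L q Sstar xstar ystar)
    (y_height : ystar = height (H L q)) :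
  forall i : 'I_n, - (beta^-1 * N) <= xstar 0 i <= beta^-1 * N.
Proof.
(* Extending [xstar] by [0] at type [0] matches the term subtracted in [f], so all types share one
   equation. *)
pose X k := if unlift ord0 k is Some i then xstar 0 i else 0.
pose P k := q k (Sstar k).
have X0 : X ord0 = 0 by rewrite /X unlift_none.
have eqX k : ystar + X k = L k (Sstar k) + \sum_j P k j * X j.
  rewrite (xy_inter k) /f subrK big_ord_recl X0 mulr0 add0r.
  by congr (_ + _); apply: eq_bigr => j _; rewrite /X liftK.
(* The lemma assumes no sign for the costs, so it also applies to [- L], [- X] and [- ystar]. *)
have eqNX k : - ystar + - X k = - L k (Sstar k) + \sum_j P k j * - X j.
  rewrite -opprD eqX opprD -sumrN; congr (_ + _).
  by apply: eq_bigr => j _; rewrite mulrN.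
have NX0 : - X ord0 = 0 by rewrite X0 oppr0.
have beta_ge0 := ltW beta_gt0.
have P_ge0 k j : 0 <= P k j by exact: q_ge0.
have P_sum1 k : \sum_j P k j = 1 by exact: q_sum1.
have P0_ge k : beta <= P k ord0 by exact: q0_ge_beta.
have [k [yk leX]] := poisson_maximum_principle beta_ge0 P_ge0 P_sum1 P0_ge X0 eqX.
have [l [yl geX]] :=
  poisson_maximum_principle beta_ge0 P_ge0 P_sum1 P0_ge NX0 eqNX.
move=> i; have Xi : X (lift ord0 i) = xstar 0 i by rewrite /X liftK.
have := leX (lift ord0 i); have := geX (lift ord0 i); rewrite Xi => geXi leXi.
have /andP[Lk_ge0 Lk_le] := L_bound k (Sstar k).
have /andP[Ll_ge0 Ll_le] := L_bound l (Sstar l).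
(* Each bound needs the sign fact from the other extremum: [beta * x_i <= L_k - y <= N] as
   [y >= L_l >= 0], and [- beta * x_i <= y - L_l <= N] as [y <= L_k <= N]. *)
rewrite lerNl !ler_pdivlMl //; apply/andP; split; lra.
Qed.
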